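(* Let $(G,T,\ell,u,w)$ be a PESP instance. If $G_1,\dots,G_k$ are the blocks of $G$ and $\mathcal P_1,\dots,\mathcal P_k$ are the fractional periodic timetabling polytopes of the subinstances on $G_1,\dots,G_k$, respectively, then the fractional periodic timetabling polytope $\mathcal P$ of the whole instance satisfies $$\mathcal P_{\mathrm{split}}=(\mathcal P_1)_{\mathrm{split}}\times\dots\times(\mathcal P_k)_{\mathrm{split}}.$$ In particular, if $G$ is a cactus graph (every arc is contained in at most one simple cycle of the underlying undirected graph), then $\mathcal P_{\mathrm{split}}=\mathcal P_{\mathrm I}$.
   Context: A PESP instance $(G,T,\ell,u,w)$ consists of a finite weakly connected directed graph $G=(V,A)$, a period $T\in\mathbb N$, $T\ge 2$, bounds $\ell,u\in\mathbb Z^A$ and weights $w\in\mathbb R^A$. The cycle space is $\mathcal C=\{\gamma\in\mathbb Z^A \mid \sum_{a\in\delta^+(i)}\gamma_a=\sum_{a\in\delta^-(i)}\gamma_a\ \forall i\in V\}$, of rank $\mu=|A|-|V|+1$. An oriented cycle is an element of $\mathcal C\cap\{-1,0,1\}^A$. An integral cycle basis is a set $B$ of $\mu$ oriented cycles forming a $\mathbb Z$-basis of $\mathcal C$; its cycle matrix $\Gamma\in\{-1,0,1\}^{B\times A}$ has the elements of $B$ as rows. The fractional and the integer periodic timetabling polytopes are $$\mathcal P=\{(x,z)\in\mathbb R^A\times\mathbb R^B\mid \Gamma x=Tz,\ \ell\le x\le u\},\qquad \mathcal P_{\mathrm I}=\operatorname{conv}\{(x,z)\in\mathbb R^A\times\mathbb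 Z^B\mid \Gamma x=Tz,\ \ell\le x\le u\}.$$ A change of integral cycle basis amounts to a unimodular change of the $z$-coordinates. The cycle space of $G$ is the direct sum of the cycle spaces of its blocks (maximal 2-connected subgraphs and bridges); the integral cycle basis of $G$ used to define $\mathcal P$ is taken to be the union of the integral cycle bases used to define $\mathcal P_1,\dots,\mathcal P_k$, so that $\mathcal P=\mathcal P_1\times\dots\times\mathcal P_k$. The subinstance on $G_j$ is obtained by restricting $\ell,u,w$ to the arcs of $G_j$. For a polyhedron $P\subseteq\mathbb R^n\times\mathbb R^p$ with variables $(x,z)$, $z$ being the integer variables, the split closure is $P_{\mathrm{split}}=\bigcap_{\beta\in\mathbb Z^p}\operatorname{conv}\{(x,z)\in P\mid\beta^\top z\in\mathbb Z\}$. *)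

(* Defs.v *)
From mathcomp Require Import all_boot all_order all_algebra.
From mathcomp Require Import classical_sets reals.

Set Implicit Arguments.
Unset Strict Implicit.
Unset Printing Implicit Defensive.

Import Order.TTheory GRing.Theory Num.Theory.

Local Open Scope ring_scope.
Local Open Scope classical_set_scope.

(* Parallel arcs, antiparallel arcs and loops are allowed. *)
Record digraph := Digraph {
  vertexT : finType;
  arcT : finType;
  src : arcT -> vertexT;
  tgt : arcT -> vertexT }.

Definition joins (G : digraph) (a : arcT G) (u v : vertexT G) : bool :=
  ((src a == u) && (tgt a == v)) || ((src a == v) && (tgt a == u)).

Definition adjacent (G : digraph) (F : {set arcT G}) : rel (vertexT G) :=
  fun u v => [exists a in F, joins a u v].

(* Meant for pairs (W, F) such that both ends of every arc of F are in W. *)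
Definition connected_in (G : digraph) (W : {set vertexT G}) (F : {set arcT G}) :
  Prop :=
  W != finset.set0 /\ {in W &, forall u v, connect (adjacent F) u v}.

Definition weakly_connected (G : digraph) : Prop :=
  connected_in [set: vertexT G]%SET [set: arcT G]%SET.

Record subgraph (G : digraph) := Subgraph {
  sub_vertices : {set vertexT G};
  sub_arcs : {set arcT G};
  sub_closed : [forall a in sub_arcs,
    (src a \in sub_vertices) && (tgt a \in sub_vertices)] }.

Lemma sub_src (G : digraph) (H : subgraph G) (a : {a | a \in sub_arcs H}) :
  src (val a) \in sub_vertices H.
Proof. by case: a => a aH; case/andP: (forall_inP (sub_closed H) a aH). Qed.

Lemma sub_tgt (G : digraph) (H : subgraph G) (a : {a | a \in sub_arcs H}) :
  tgt (val a) \in sub_vertices H.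
Proof. by case: a => a aH; case/andP: (forall_inP (sub_closed H) a aH). Qed.

Definition subgraph_digraph (G : digraph) (H : subgraph G) : digraph :=
  @Digraph {v | v \in sub_vertices H} {a | a \in sub_arcs H}
    (fun a => exist _ (src (val a)) (sub_src a))
    (fun a => exist _ (tgt (val a)) (sub_tgt a)).

Definition is_loop (G : digraph) (a : arcT G) : bool := src a == tgt a.

(* In a multigraph, two vertices joined by at least two arcs form a            *)
(* 2-connected graph, whereas a single arc does not; loops are excluded here,  *)
(* since each of them is a block of its own.                                   *)
Definition two_connected (G : digraph) (H : subgraph G) : Prop :=
  [/\ forall a, a \in sub_arcs H -> ~~ is_loop a,
      (2 <= #|sub_vertices H|)%N,
      (2 <= #|sub_arcs H|)%N,
      connected_in (sub_vertices H) (sub_arcs H) &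
      forall v, v \in sub_vertices H ->
        connected_in (sub_vertices H :\ v)%SET
          [set a in sub_arcs H | (src a != v) && (tgt a != v)]%SET].

Definition maximal_two_connected (G : digraph) (H : subgraph G) : Prop :=
  two_connected H /\
  forall H' : subgraph G, two_connected H' ->
    sub_vertices H \subset sub_vertices H' -> sub_arcs H \subset sub_arcs H' ->
    H' = H.

(* For connected G. *)
Definition is_bridge (G : digraph) (a : arcT G) : Prop :=
  ~ connected_in [set: vertexT G]%SET (~: [set a])%SET.

Definition is_block (G : digraph) (H : subgraph G) : Prop :=
  maximal_two_connected H \/
  exists a : arcT G,
    [/\ is_bridge a \/ is_loop a,
        sub_vertices H = [set src a; tgt a]%SET & sub_arcs H = [set a]%SET].

Definition blocks_enum (G : digraph) (k : nat) (Gs : 'I_k -> subgraph G) :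
  Prop :=
  injective Gs /\ forall H : subgraph G, is_block H <-> exists j, Gs j = H.

(* The arc sets of the simple cycles of the underlying undirected multigraph;  *)
(* thus a loop and a pair of (anti)parallel arcs are cycles.                   *)
Definition simple_cycle (G : digraph) (C : {set arcT G}) : Prop :=
  exists n : nat, exists v : 'I_n -> vertexT G, exists e : 'I_n -> arcT G,
    [/\ (0 < n)%N, injective v, injective e,
        forall i, joins (e i) (v i) (v (ordS i)) &
        C = [set e i | i : 'I_n]%SET].

Definition cactus (G : digraph) : Prop :=
  forall (a : arcT G) (C C' : {set arcT G}),
    simple_cycle C -> simple_cycle C' -> a \in C -> a \in C' -> C = C'.

Definition cycle_space (G : digraph) (g : {ffun arcT G -> int}) : Prop :=
  forall i : vertexT G, \sum_(a | src a == i) g a = \sum_(a | tgt a == i) g a.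

Definition oriented_cycle (G : digraph) (g : {ffun arcT G -> int}) : Prop :=
  cycle_space g /\ forall a, g a \in [:: -1; 0; 1].

(* The basis is the family of the rows of its cycle matrix; the condition      *)
(* #|B| = |A| - |V| + 1 is stated without truncated subtraction.               *)
Definition integral_cycle_basis (G : digraph) (B : finType)
    (Gamma : B -> {ffun arcT G -> int}) : Prop :=
  [/\ forall b, oriented_cycle (Gamma b),
      (#|B| + #|vertexT G| = #|arcT G| + 1)%N &
      forall g, cycle_space g ->
        exists! c : {ffun B -> int}, g = \sum_(b : B) Gamma b *~ c b].

Definition union_basis (G : digraph) (k : nat) (Gs : 'I_k -> subgraph G)
    (B : 'I_k -> finType)
    (Gamma : forall j, B j -> {ffun arcT (subgraph_digraph (Gs j)) -> int}) :
    {j : 'I_k & B j} -> {ffun arcT G -> int} :=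
  fun b => [ffun a =>
    if insub a is Some a' then Gamma (tag b) (tagged b) a' else 0].

Record pesp (R : realType) := Pesp {
  network : digraph;
  period : nat;
  lower : {ffun arcT network -> int};
  upper : {ffun arcT network -> int};
  weight : {ffun arcT network -> R} }.

Definition pesp_instance (R : realType) (I : pesp R) : Prop :=
  weakly_connected (network I) /\ (2 <= period I)%N.

Definition subinstance (R : realType) (I : pesp R) (H : subgraph (network I)) :
    pesp R :=
  @Pesp R (subgraph_digraph H) (period I)
    [ffun a => lower I (val a)] [ffun a => upper I (val a)]
    [ffun a => weight I (val a)].

Definition convex_hull (R : realType) (V : lmodType R) (S : set V) : set V :=
  [set x | exists n : nat, exists c : 'I_n -> R, exists y : 'I_n -> V,
    [/\ forall i, 0 <= c i, \sum_(i < n) c i = 1, forall i, S (y i) &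
        x = \sum_(i < n) c i *: y i]].

(* R^o is R viewed as an lmodType over itself. *)
Definition mixed_space (R : realType) (X Z : finType) : lmodType R :=
  ({ffun X -> R^o} * {ffun Z -> R^o})%type.

Definition xcoord (R : realType) (X Z : finType) (p : mixed_space R X Z)
    (a : X) : R := p.1 a.

Definition zcoord (R : realType) (X Z : finType) (p : mixed_space R X Z)
    (b : Z) : R := p.2 b.

Definition split_closure (R : realType) (X Z : finType)
    (P : set (mixed_space R X Z)) : set (mixed_space R X Z) :=
  \bigcap_(beta : {ffun Z -> int})
    convex_hull [set p : mixed_space R X Z |
      P p /\ \sum_b (beta b)%:~R * zcoord p b \is a Num.int].

Definition frac_polytope (R : realType) (I : pesp R) (B : finType)
    (Gamma : B -> {ffun arcT (network I) -> int}) :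
    set (mixed_space R (arcT (network I)) B) :=
  [set p : mixed_space R (arcT (network I)) B |
    (forall b, \sum_a (Gamma b a)%:~R * xcoord p a =
               (period I)%:R * zcoord p b) /\
    (forall a, (lower I a)%:~R <= xcoord p a <= (upper I a)%:~R)].

Definition int_polytope (R : realType) (I : pesp R) (B : finType)
    (Gamma : B -> {ffun arcT (network I) -> int}) :
    set (mixed_space R (arcT (network I)) B) :=
  convex_hull [set p : mixed_space R (arcT (network I)) B |
    frac_polytope Gamma p /\ forall b, zcoord p b \is a Num.int].

(* The coordinates of p that belong to the j-th subgraph. *)
Definition block_coords (R : realType) (G : digraph) (k : nat)
    (Gs : 'I_k -> subgraph G) (B : 'I_k -> finType) (j : 'I_k)
    (p : mixed_space R (arcT G) {j : 'I_k & B j}) :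
    mixed_space R (arcT (subgraph_digraph (Gs j))) (B j) :=
  ([ffun a => xcoord p (val a)], [ffun b => zcoord p (Tagged B b)]).

(* Since every arc lies in exactly one block, for the blocks of G a point is   *)
(* the same thing as the tuple of its block coordinates.                       *)
Definition block_product (R : realType) (G : digraph) (k : nat)
    (Gs : 'I_k -> subgraph G) (B : 'I_k -> finType)
    (S : forall j, set (mixed_space R (arcT (subgraph_digraph (Gs j))) (B j))) :
    set (mixed_space R (arcT G) {j : 'I_k & B j}) :=
  [set p | forall j, S j (block_coords Gs j p)].

(* Main.v *)
(* An integer functional beta on the cycle coordinates restricts to
   functionals beta_j on the blocks, and beta z = sum_j beta_j z_j is an
   integer as soon as all beta_j z_j are; conversely each beta_j extends by
   zero.  As every arc lies in exactly one block, the fractional polytope is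
   the product of the P_j, and a product of convex hulls lies in the convex
   hull of the product, which gives the first claim.

   In a cactus all arcs of a 2-connected block lie on one simple cycle, so
   the cycle space of each block has rank at most 1.  The single split
   beta_j = 1 then already yields the integer hull of P_j. *)

Require Import Defs.
From HB Require Import structures.
From mathcomp Require Import all_boot all_order all_algebra.
From mathcomp Require Import boolp classical_sets reals.

Set Implicit Arguments.
Unset Strict Implicit.
Unset Printing Implicit Defensive.

Import Order.TTheory GRing.Theory Num.Theory.

Local Open Scope ring_scope.
Local Open Scope classical_set_scope.

(** * Products of convex hulls *)

Lemma big_sig_tag (A : nmodType) (I : finType) (T : I -> finType)
    (F : {i : I & T i} -> A) :
  \sum_(u : {i : I & T i}) F u = \sum_(i : I) \sum_(x : T i) F (Tagged T x).
Proof.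
rewrite (sig_big_dep xpredT (fun=> xpredT) (fun i x => F (Tagged T x))) /=.
by apply: eq_bigr => -[].
Qed.

(** Distributivity when the index type varies with [i]: expand over functions into the tagged union,
    then use [big_fprod] to turn these into dependent choices. *)
Lemma prod_sum_fprod (A : comPzRingType) (I : finType) (T : I -> finType)
    (F : forall i, T i -> A) :
  \prod_(i : I) \sum_(x : T i) F i x =
  \sum_(t : fprod T) \prod_(i : I) F i (t i).
Proof.
pose P i := [ffun x => F i x].
transitivity (\sum_(t : fprod T) \prod_(i in I) P i (t i)); last first.
  by apply: eq_bigr => t _; apply: eq_bigr => i _; rewrite ffunE.
rewrite big_fprod
  -(bigA_distr_big_dep (tagged_with T) (fun i => untag 0 (P i))).
apply: eq_bigr => i _; symmetry.
transitivity (\sum_(u | tagged_with T i u) untag 0 (P i) u) => //.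
rewrite big_mkcond big_sig_tag (bigD1 i) //=.
rewrite [X in _ + X]big1 ?addr0 => [|j ji]; last first.
  by rewrite big1 // => x _; rewrite /tagged_with /= (negbTE ji).
apply: eq_bigr => x _; rewrite /tagged_with /= eqxx.
by rewrite (untagE _ _ (erefl : tag (Tagged T x) = i)) /= ffunE.
Qed.

(** The weights [c j] act like independent distributions: grouping the choices by their value at [i]
    leaves the marginal [c i], as every other factor sums to 1. *)
Lemma sum_fprod_marginal (A : comPzRingType) (V : lmodType A) (I : finType)
    (T : I -> finType) (c : forall i, T i -> A) (i : I) (g : T i -> V) :
    (forall j, \sum_x c j x = 1) ->
  \sum_(t : fprod T) (\prod_j c j (t j)) *: g (t i) = \sum_x c i x *: g x.
Proof.
move=> c1; rewrite (partition_big (fun t : fprod T => t i) xpredT) //=.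
apply: eq_bigr => x _.
under eq_bigr => t /eqP -> do [].
rewrite -scaler_suml; congr (_ *: _); rewrite big_mkcond /=.
(* The condition [t i = x] becomes an indicator inside the [i]-th factor, so that the sum runs over
   all choices and factorizes. Tagged elements are compared because [T j] and [T i] are different
   types. *)
pose d j (y : T j) : A :=
  c j y * ((j == i) ==> (Tagged T y == Tagged T x))%:R.
transitivity (\sum_(t : fprod T) \prod_j d j (t j)).
  apply: eq_bigr => t _; rewrite big_split /= [X in _ * X](bigD1 i) //= eqxx /=.
  rewrite eq_Tagged [X in _ * (_ * X)]big1 ?mulr1 => [|j /negbTE -> //].
  by case: eqP; rewrite ?mulr1 ?mulr0.
rewrite -prod_sum_fprod (bigD1 i) //= (bigD1 x) //= /d !eqxx mulr1.
rewrite !big1 ?addr0 ?mulr1 // => [j /negbTE ji|y yx].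
  by under eq_bigr do rewrite ji mulr1; exact: c1.
by rewrite eq_Tagged (negbTE yx) mulr0.
Qed.

Lemma convex_hull_fin (R : realType) (V : lmodType R) (S : set V) (T : finType)
    (c : T -> R) (y : T -> V) :
    (forall t, 0 <= c t) -> \sum_t c t = 1 -> (forall t, S (y t)) ->
  convex_hull S (\sum_t c t *: y t).
Proof.
move=> c0 c1 Sy; exists #|T|, (c \o enum_val), (y \o enum_val); split=> //=.
  by rewrite -(big_enum_val (A := T) c) -[RHS]c1; apply: eq_bigl.
rewrite -(big_enum_val (A := T) (fun t => c t *: y t)).
by apply: eq_bigl.
Qed.

Lemma convex_hull_linear (R : realType) (V W : lmodType R)
    (f : {linear V -> W}) (S : set V) (S' : set W) (p : V) :
  (forall q, S q -> S' (f q)) -> convex_hull S p -> convex_hull S' (f p).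
Proof.
move=> SS' [n [c [y [c0 c1 Sy ->]]]].
exists n, c, (f \o y); split=> // [i|]; first exact: SS'.
by rewrite linear_sum; apply: eq_bigr => i _; rewrite linearZ.
Qed.

Lemma convex_hull_mono (R : realType) (V : lmodType R) (S S' : set V) :
  S `<=` S' -> convex_hull S `<=` convex_hull S'.
Proof.
move=> SS' p [n [c [y [c0 c1 Sy ->]]]].
by exists n, c, y; split=> // i; exact: SS'.
Qed.

(* Weighting the choice of one point per factor by the product of the          *)
(* coefficients reproduces the given convex combination in each factor.        *)
Lemma convex_hull_product (R : realType) (I : finType) (V : lmodType R)
    (W : I -> lmodType R) (f : forall i, {linear V -> W i})
    (S : forall i, set (W i)) (p : V) :
    (forall q q', (forall i, f i q = f i q') -> q = q') ->
    (forall y : forall i, W i, exists q, forall i, f i q = y i) ->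
    (forall i, convex_hull (S i) (f i p)) ->
  convex_hull [set q | forall i, S i (f i q)] p.
Proof.
move=> f_inj f_surj Sp.
have [n {}Sp] := fin_all_exists Sp; have [c {}Sp] := fin_all_exists Sp.
have [y {}Sp] := fin_all_exists Sp.
pose T i : finType := 'I_(n i).
have ex_q (t : fprod T) : exists q, forall i, f i q = y i (t i).
  exact: f_surj.
have [q qE] := fin_all_exists ex_q.
have -> : p = \sum_(t : fprod T) (\prod_i c i (t i)) *: q t.
  apply: f_inj => i; rewrite linear_sum.
  under eq_bigr do rewrite linearZ qE.
  by rewrite sum_fprod_marginal => [|j]; [case: (Sp i)|case: (Sp j)].
apply: convex_hull_fin => [t||t i].
- by apply: prodr_ge0 => i _; case: (Sp i).
- by rewrite -prod_sum_fprod big1 // => i _; case: (Sp i).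
by rewrite qE; case: (Sp i).
Qed.

(** * Blocks *)

Section Blocks.
Import mathcomp.boot.fintype mathcomp.boot.finset.
Local Open Scope nat_scope.
Local Open Scope set_scope.
Variable G : digraph.
Implicit Types (a b : arcT G) (u v w : vertexT G) (F : {set arcT G})
  (W : {set vertexT G}) (H : subgraph G).

(** * Walks and connectivity within a set of arcs *)

Lemma joins_sym a u v : joins a u v = joins a v u.
Proof. by rewrite /joins orbC. Qed.

Lemma joins_src_tgt a : joins a (src a) (tgt a).
Proof. by rewrite /joins !eqxx. Qed.

Lemma joins_ends a u v u' v' : joins a u v -> joins a u' v' ->
  u = u' /\ v = v' \/ u = v' /\ v = u'.
Proof.
rewrite /joins => /orP[]/andP[/eqP <- /eqP <-] /orP[]/andP[/eqP <- /eqP <-];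
by [left | right].
Qed.

Lemma joins_loop a u v : joins a u v -> is_loop a = (u == v).
Proof.
by rewrite /is_loop; case/orP=> /andP[/eqP <- /eqP <-] //; rewrite eq_sym.
Qed.

Lemma connect_adjacent_sym F : connect_sym (adjacent F).
Proof.
apply: sym_connect_sym => u v; apply/exists_inP/exists_inP => -[a aF auv];
by exists a; rewrite // joins_sym.
Qed.

Lemma connect_arc F a u v : a \in F -> joins a u v -> connect (adjacent F) u v.
Proof. by move=> aF auv; apply/connect1/exists_inP; exists a. Qed.

(** Each arc of a walk in [F] is replaced by a walk in [F'] between its ends. *)
Lemma connect_adjacent_arcs F F' u v :
    (forall a, a \in F -> connect (adjacent F') (src a) (tgt a)) ->
  connect (adjacent F) u v -> connect (adjacent F') u v.
Proof.
move=> FF'; move: u v; apply: connect_sub => u v /exists_inP[a aF].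
by case/orP=> /andP[/eqP<- /eqP<-]; rewrite ?FF' // connect_adjacent_sym FF'.
Qed.

Lemma connect_adjacentS F F' u v : F \subset F' ->
  connect (adjacent F) u v -> connect (adjacent F') u v.
Proof.
move=> /subsetP FF'; apply: connect_adjacent_arcs => a /FF' aF'.
exact: connect_arc aF' (joins_src_tgt a).
Qed.

Lemma connected_in_root W F w : w \in W ->
  (forall u, u \in W -> connect (adjacent F) w u) -> connected_in W F.
Proof.
move=> wW conn; split=> [|u v uW vW]; first by apply/set0Pn; exists w.
by apply: (@connect_trans _ _ w); [rewrite connect_adjacent_sym|]; apply: conn.
Qed.

Lemma connected_inU W F W' F' w : w \in W -> w \in W' ->
  connected_in W F -> connected_in W' F' -> connected_in (W :|: W') (F :|: F').
Proof.
move=> wW wW' [_ cF] [_ cF']; apply: (@connected_in_root _ _ w) => [|u].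
  by rewrite inE wW.
rewrite inE => /orP[uW|uW'].
  exact: (connect_adjacentS (subsetUl _ _) (cF _ _ wW uW)).
exact: connect_adjacentS (subsetUr _ _) (cF' _ _ wW' uW').
Qed.

Lemma subgraph_ext H H' :
  sub_vertices H = sub_vertices H' -> sub_arcs H = sub_arcs H' -> H = H'.
Proof.
case: H H' => [W F cl] [W' F' cl'] /= eW eF.
by move: cl cl'; rewrite eW eF => cl cl'; rewrite (bool_irrelevance cl cl').
Qed.

Lemma joins_sub H a u v : a \in sub_arcs H -> joins a u v ->
  (u \in sub_vertices H) && (v \in sub_vertices H).
Proof.
move=> aH; have /andP[s t] := forall_inP (sub_closed H) a aH.
by case/orP=> /andP[/eqP <- /eqP <-]; apply/andP.
Qed.

(** Names the arc set that occurs in the vertex deletion clause of [two_connected]. *)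
Definition arcs_avoiding F v : {set arcT G} :=
  [set a in F | (src a != v) && (tgt a != v)].

Lemma arcs_avoidingP F v a u w : joins a u w ->
  (a \in arcs_avoiding F v) = [&& a \in F, u != v & w != v].
Proof.
by case/orP=> /andP[/eqP <- /eqP <-]; rewrite inE // [X in _ && X]andbC.
Qed.

(** * Unions and arc deletions in 2-connected subgraphs *)

Fact unionsub_closed H H' : [forall a in sub_arcs H :|: sub_arcs H',
  (src a \in sub_vertices H :|: sub_vertices H') &&
  (tgt a \in sub_vertices H :|: sub_vertices H')].
Proof.
apply/forall_inP => a; rewrite !inE => /orP[] aH;
by case/andP: (joins_sub aH (joins_src_tgt a)) => -> ->; rewrite ?orbT.
Qed.

(** The common arc is not a loop, so after deletion of any vertex one of its ends survives and glues
    the two connected remainders together. *)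
Lemma two_connectedU H H' a : two_connected H -> two_connected H' ->
  a \in sub_arcs H -> a \in sub_arcs H' ->
  two_connected (Subgraph (unionsub_closed H H')).
Proof.
move=> [nl cW cF conn cut] [nl' cW' cF' conn' cut'] aH aH'.
have /andP[sH tH] := joins_sub aH (joins_src_tgt a).
have /andP[sH' tH'] := joins_sub aH' (joins_src_tgt a).
(* The deletion clause also holds for [v] outside [K], where deleting [v] changes nothing. *)
have avoid K v : two_connected K ->
    connected_in (sub_vertices K :\ v) (arcs_avoiding (sub_arcs K) v).
  move=> [_ _ _ connK cutK]; have [vK|vK] := boolP (v \in sub_vertices K).
    exact: cutK.
  have -> : sub_vertices K :\ v = sub_vertices K.
    by apply/setP => u; rewrite !inE andb_idl //; apply: contraTneq => ->.
  suff -> : arcs_avoiding (sub_arcs K) v = sub_arcs K by [].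
  apply/setP => b; rewrite inE andb_idr // => bK.
  case/andP: (joins_sub bK (joins_src_tgt b)) => sK tK.
  by apply/andP; split; apply: contraNneq vK => <-.
split=> /=.
- by move=> b; rewrite inE => /orP[/nl|/nl'].
- exact: leq_trans cW (subset_leq_card (subsetUl _ _)).
- exact: leq_trans cF (subset_leq_card (subsetUl _ _)).
- exact: connected_inU sH sH' conn conn'.
move=> v _; rewrite -/(arcs_avoiding _ v).
have [w [wH wH' wv]] : exists w,
    [/\ w \in sub_vertices H, w \in sub_vertices H' & w != v].
  have [sv|sv] := eqVneq (src a) v; last by exists (src a).
  by exists (tgt a); split=> //; rewrite -sv eq_sym; exact: nl aH.
have -> : arcs_avoiding (sub_arcs H :|: sub_arcs H') v =
    arcs_avoiding (sub_arcs H) v :|: arcs_avoiding (sub_arcs H') v.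
  by apply/setP => b; rewrite !inE -andb_orl.
rewrite setDUl; apply: (@connected_inU _ _ _ _ w); rewrite ?inE ?wv //;
by apply: avoid; split.
Qed.

(** With a third vertex [w], go from [src a] to [w] avoiding [tgt a], then on to [tgt a] avoiding
    [src a]; neither walk uses [a]. With only two vertices, a second arc exists and, not being a
    loop, joins the same ends. *)
Lemma two_connected_connectD1 H a : two_connected H -> a \in sub_arcs H ->
  connect (adjacent (sub_arcs H :\ a)) (src a) (tgt a).
Proof.
move=> [nl cW cF conn cut] aH.
have /andP[sH tH] := joins_sub aH (joins_src_tgt a).
have st : src a != tgt a := nl _ aH.
have avoidS v : (src a == v) || (tgt a == v) ->
    arcs_avoiding (sub_arcs H) v \subset sub_arcs H :\ a.
  move=> av; apply/subsetP => b; rewrite !inE => /and3P[-> bs bt].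
  by rewrite andbT; apply: contraL av => /eqP <-; rewrite negb_or bs.
have [w /and3P[wH ws wt]|only] :=
    pickP [pred w | [&& w \in sub_vertices H, w != src a & w != tgt a]].
  apply: (@connect_trans _ _ w).
    apply: connect_adjacentS (avoidS (tgt a) _) _; first by rewrite eqxx orbT.
    by case: (cut _ tH) => _; apply; rewrite !inE ?st ?wt.
  apply: connect_adjacentS (avoidS (src a) _) _; first by rewrite eqxx.
  by case: (cut _ sH) => _; apply; rewrite !inE ?ws // eq_sym st.
have /card_gt0P[b] : 0 < #|sub_arcs H :\ a|.
  by rewrite (cardsD1 a) aH in cF.
rewrite in_setD1 => /andP[ba bH].
apply: (@connect_arc _ b); first by rewrite in_setD1 ba.
have /andP[sbH tbH] := joins_sub bH (joins_src_tgt b).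
have /= := only (src b); have /= := only (tgt b); rewrite sbH tbH /=.
move=> /negbT; rewrite negb_and !negbK => tb.
move=> /negbT; rewrite negb_and !negbK => sb.
have := nl _ bH; rewrite /is_loop /joins.
by case/orP: tb => /eqP ->; case/orP: sb => /eqP ->; rewrite ?eqxx // orbT.
Qed.

(** * Bridges and cycles *)

Lemma not_bridgeP a : weakly_connected G ->
  ~ is_bridge a <-> connect (adjacent (~: [set a])) (src a) (tgt a).
Proof.
move=> [W0 conn]; split=> [nb|st].
  by apply: contrapT => nst; apply: nb => -[_ c]; apply: nst; apply: c.
apply; split=> // u v uG vG; apply: connect_adjacent_arcs _ (conn u v uG vG).
move=> b _; have [-> //|ba] := eqVneq b a.
by apply: connect_arc (joins_src_tgt b); rewrite !inE.
Qed.

Lemma two_connected_not_bridge H a : weakly_connected G -> two_connected H ->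
  a \in sub_arcs H -> ~ is_bridge a.
Proof.
move=> hG hH aH; apply/(not_bridgeP _ hG).
apply: connect_adjacentS _ (two_connected_connectD1 hH aH).
by apply/subsetP => b; rewrite !inE => /andP[].
Qed.

(** A walk from [s] to [t] is shortened to a simple path and closed by [a]; since [s != t] the cycle
    has length at least 2. Fixing [s] as first vertex and [a] as last arc lets later arguments
    identify the first arc. *)
Lemma path_cycle F a s t : a \notin F -> joins a s t -> s != t ->
    connect (adjacent F) s t ->
  exists n (v : 'I_n.+2 -> vertexT G) (e : 'I_n.+2 -> arcT G),
    [/\ injective v, injective e, forall i, joins (e i) (v i) (v (ordS i)) &
        [/\ v ord0 = s, e ord_max = a & forall i, i != ord_max -> e i \in F]].
Proof.
move=> aF ast st /connectP[p0 p0F tE].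
case/shortenP: p0F tE => p pF p_uniq _ tE {p0}.
case: p pF p_uniq tE => [_ _ /= tE|y p]; first by rewrite tE eqxx in st.
set q := y :: p => pF p_uniq tE.
(* The default [s] is never reached: the list has exactly [(size p).+2] entries. *)
pose v (i : 'I_(size p).+2) := nth s (s :: q) i.
have v_inj : injective v.
  by move=> i j /eqP; rewrite nth_uniq // => /eqP /val_inj.
have ordSE (i : 'I_(size p).+2) : i != ord_max -> val (ordS i) = i.+1.
  move=> im; rewrite /= modn_small // ltnS ltn_neqAle -ltnS ltn_ord andbT.
  by apply: contraNneq im => im; apply/eqP/val_inj.
have /fin_all_exists[e eP] (i : 'I_(size p).+2) : exists b,
    joins b (v i) (v (ordS i)) /\ if i == ord_max then b = a else b \in F.
  case: eqVneq => [->|im].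
    exists a; split=> //; rewrite joins_sym /v /= modnn /= -last_nth.
    by rewrite tE in ast.
  have iq : i < size q.
    by rewrite -ltnS -(ordSE i im); apply: ltn_ord.
  have /exists_inP[b bF bj] := pathP s pF i iq.
  by exists b; rewrite /v ordSE.
exists (size p), v, e; split=> //; last 1 first.
- split=> // [|i im]; first by have := (eP ord_max).2; rewrite eqxx.
  by have := (eP i).2; rewrite (negbTE im).
(* The closing arc is distinguished by lying outside [F]. Two equal path arcs have the same ends;
   matching them crosswise would make each index the successor of the other. *)
- move=> i j eij; have [ji ei] := eP i; have [jj ej] := eP j.
  rewrite -eij in jj ej.
  case: eqVneq ei ej => [->|im] ei; case: eqVneq => [->|jm] //.
    by rewrite ei (negbTE aF).
  by move=> ea; rewrite ea (negbTE aF) in ei.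
  move=> _; case: (joins_ends ji jj) => -[/v_inj // e1 /v_inj e2].
  have := congr1 val e1; have := congr1 val e2; rewrite !ordSE // => <- ij.
  by have := ltnW (ltnSn i.+1); rewrite -ij ltnn.
by move=> i; case: (eP i).
Qed.

Lemma val_iter_ordS n (i : 'I_n) m : val (iter m (@ordS n) i) = (i + m) %% n.
Proof.
elim: m => [|m IHm]; first by rewrite addn0 modn_small.
by rewrite iterS /= IHm -addn1 modnDml addn1 addnS.
Qed.

(** Allows induction around a cycle from an arbitrary starting index. *)
Lemma iter_ordS_eq n (i j : 'I_n) : exists2 m, m < n & j = iter m (@ordS n) i.
Proof.
have n0 : 0 < n by apply: leq_ltn_trans (ltn_ord i).
(* This is [j - i] modulo [n], arranged so that the natural subtraction does not truncate. *)
exists ((j + (n - i)) %% n); first exact: ltn_pmod.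
apply: val_inj; rewrite [RHS]val_iter_ordS modnDmr addnCA.
by rewrite (subnKC (ltnW (ltn_ord i))) modnDr modn_small.
Qed.

Lemma iter_ordS_neq n (i : 'I_n) m : 0 < m -> m < n ->
  iter m (@ordS n) i != i.
Proof.
move=> m0 mn; rewrite -val_eqE /= val_iter_ordS.
rewrite -[X in _ != X](modn_small (ltn_ord i)) -[X in _ != X %% _]addn0.
by rewrite eqn_modDl mod0n modn_small // -lt0n.
Qed.

(** Deleting [v i0] leaves a path: every other vertex is reached by going forward from
    [v (ordS i0)], never returning to [i0] in fewer than [n.+2] steps. *)
Lemma cycle_two_connected n (v : 'I_n.+2 -> vertexT G)
    (e : 'I_n.+2 -> arcT G) :
    injective v -> injective e -> (forall i, joins (e i) (v i) (v (ordS i))) ->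
  exists2 H, two_connected H & sub_arcs H = [set e i | i : 'I_n.+2].
Proof.
move=> v_inj e_inj ev.
have cl : [forall a in [set e i | i : 'I_n.+2],
    (src a \in [set v i | i : 'I_n.+2]) && (tgt a \in [set v i | i : 'I_n.+2])].
  apply/forall_inP => _ /imsetP[i _ ->].
  by case/orP: (ev i) => /andP[/eqP -> /eqP ->]; rewrite !imset_f.
exists (Subgraph cl) => //; split=> /=.
- move=> _ /imsetP[i _ ->]; rewrite (joins_loop (ev i)) (inj_eq v_inj) eq_sym.
  exact: (@iter_ordS_neq _ i 1).
- by rewrite card_imset // card_ord.
- by rewrite card_imset // card_ord.
- apply: (@connected_in_root _ _ (v ord0)) => [|_ /imsetP[i _ ->]].
    exact: imset_f.
  have [m _ ->] := iter_ordS_eq ord0 i; elim: m => [|m IHm] //=.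
  by apply: connect_trans IHm _; apply: connect_arc (ev _); apply: imset_f.
move=> _ /imsetP[i0 _ ->]; rewrite -/(arcs_avoiding _ _).
apply: (@connected_in_root _ _ (v (ordS i0))).
  by rewrite !inE (inj_eq v_inj) imset_f // (@iter_ordS_neq _ i0 1).
move=> u /setD1P[+ /imsetP[i _ uE]]; rewrite {u}uE.
have [m mn ->] := iter_ordS_eq i0 i.
case: m mn => [|m]; first by rewrite eqxx.
elim: m => [|m IHm] mn _ //.
apply: connect_trans (IHm (ltnW mn) _) _.
  by rewrite (inj_eq v_inj) iter_ordS_neq // ltnW.
apply: connect_arc (ev _); rewrite (arcs_avoidingP _ _ (ev _)) imset_f //.
by rewrite !(inj_eq v_inj) iter_ordS_neq ?(@iter_ordS_neq _ i0 m.+2) // ltnW.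
Qed.

(** Enlarge as long as possible; the number of vertices and arcs left outside drops at each step. *)
Lemma two_connected_maximal H : two_connected H ->
  exists2 H', maximal_two_connected H' & sub_arcs H \subset sub_arcs H'.
Proof.
have [n] := ubnP (#|~: sub_vertices H| + #|~: sub_arcs H|).
elim: n => // n IHn in H * => leHn hH.
have [[H' [hH' sV sA neq]]|no] := pselect (exists H', [/\ two_connected H',
    sub_vertices H \subset sub_vertices H', sub_arcs H \subset sub_arcs H' &
    H' <> H]).
  have [|//|K hK sK] := IHn H' _; last by exists K => //; apply: subset_trans sK.
  rewrite ltnS in leHn; apply: leq_trans leHn.
  have cV : #|~: sub_vertices H'| <= #|~: sub_vertices H|.
    by rewrite subset_leq_card // setCS.
  have cA : #|~: sub_arcs H'| <= #|~: sub_arcs H|.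
    by rewrite subset_leq_card // setCS.
  (* Both summands can only shrink, so equal totals force equality of the vertex sets and of the arc
     sets. *)
  rewrite ltn_neqAle leq_add // andbT; apply/eqP => eq_card; apply: neq.
  apply: subgraph_ext; apply: setC_inj; apply/eqP; rewrite eqEcard setCS ?sV ?sA.
    by rewrite /= -(leq_add2r #|~: sub_arcs H'|) eq_card leq_add2l.
  by rewrite /= -(leq_add2l #|~: sub_vertices H'|) eq_card leq_add2r.
exists H => //; split=> // H' hH' sV sA.
by apply: contrapT => neq; apply: no; exists H'.
Qed.

(** * Every arc lies in exactly one block *)

Fact arc_sub_closed a :
  [forall b in [set a], (src b \in [set src a; tgt a]) &&
                        (tgt b \in [set src a; tgt a])].
Proof. by apply/forall_inP => b /set1P->; rewrite !inE !eqxx orbT. Qed.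

(** An arc that is neither a bridge nor a loop closes a path avoiding it; the resulting cycle is
    2-connected and extends to a maximal 2-connected subgraph. *)
Lemma arc_in_block a : weakly_connected G ->
  exists2 H, is_block H & a \in sub_arcs H.
Proof.
move=> hG; have [ba|nba] := pselect (is_bridge a \/ is_loop a).
  exists (Subgraph (arc_sub_closed a)); last exact: set11.
  by right; exists a.
have /(not_bridgeP _ hG) st : ~ is_bridge a by move=> ?; apply: nba; left.
have nloop : src a != tgt a by apply/negP => ?; apply: nba; right.
have [|n [v [e [v_inj e_inj ev [_ ea _]]]]] :=
    path_cycle _ (joins_src_tgt a) nloop st.
  by rewrite !inE eqxx.
have [H hH HE] := cycle_two_connected v_inj e_inj ev.
have [H' hH' sub] := two_connected_maximal hH.
by exists H'; [left|apply: (subsetP sub); rewrite HE -ea imset_f].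
Qed.

(** Two maximal 2-connected subgraphs sharing an arc both equal their union, and no bridge or loop
    lies in a 2-connected subgraph, which excludes the mixed cases. *)
Lemma block_unique H H' a : weakly_connected G -> is_block H -> is_block H' ->
  a \in sub_arcs H -> a \in sub_arcs H' -> H = H'.
Proof.
move=> hG.
have excl K b : two_connected K -> b \in sub_arcs K ->
    ~ (is_bridge b \/ is_loop b).
  move=> hK bK [/(two_connected_not_bridge hG hK bK) //|].
  by case: hK => /(_ b bK) /negP.
move=> [[hH maxH]|[b [hb HV HA]]] [[hH' maxH']|[b' [hb' HV' HA']]] aH aH'.
- have hU := two_connectedU hH hH' aH aH'.
  rewrite -(maxH _ hU) ?subsetUl // -[RHS](maxH' _ hU) ?subsetUr //.
- by move: aH'; rewrite HA' => /set1P ab'; case: (excl H a hH aH); rewrite ab'.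
- by move: aH; rewrite HA => /set1P ab; case: (excl H' a hH' aH'); rewrite ab.
move: aH aH'; rewrite HA HA' => /set1P ab /set1P ab'.
by apply: subgraph_ext; rewrite ?HV ?HV' ?HA ?HA' -ab -ab'.
Qed.

(** * Blocks of a cactus *)

Lemma two_connected_cycle_through H a b u s t : two_connected H ->
    a \in sub_arcs H -> b \in sub_arcs H -> a != b ->
    joins a u s -> joins b u t ->
  exists2 C, simple_cycle C & (a \in C) && (b \in C).
Proof.
move=> [nl _ _ _ cut] aH bH ab au bu.
have /andP[uH sH] := joins_sub aH au; have /andP[_ tH] := joins_sub bH bu.
have us : u != s by rewrite -(joins_loop au) nl.
have ut : u != t by rewrite -(joins_loop bu) nl.
(* In [F] only [a] is incident to [u], so a path in [F] from [u] to [t] starts with [a]; closing it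
   by [b] gives a cycle through both arcs. *)
pose F := a |: arcs_avoiding (sub_arcs H) u.
have uF c w : joins c u w -> c \in F -> c = a.
  by move=> cu; rewrite in_setU1 (arcs_avoidingP _ _ cu) eqxx andbF orbF => /eqP.
have [||n [v [e [v_inj e_inj ev [v0 eb eF]]]]] := @path_cycle F b u t _ bu ut.
- by apply/negP => /(uF _ _ bu)/eqP; rewrite eq_sym (negbTE ab).
- apply: (@connect_trans _ _ s); first by apply: connect_arc au; apply: setU11.
  apply: connect_adjacentS (subsetUr _ _) _.
  by case: (cut u uH) => _; apply; rewrite !inE 1?eq_sym ?us ?ut // eq_sym.
exists [set e i | i : 'I_n.+2]; first by exists n.+2, v, e; split.
rewrite -eb imset_f // andbT; apply/imsetP; exists ord0 => //.
by apply/esym/(uF _ (v (ordS ord0))); [rewrite -v0|apply: eF].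
Qed.

Lemma two_connected_arc_cycle H a : two_connected H -> a \in sub_arcs H ->
  exists2 C, simple_cycle C & a \in C.
Proof.
move=> hH aH; have nl : src a != tgt a by case: hH => /(_ a aH).
have [|n [v [e [v_inj e_inj ev [_ ea _]]]]] :=
  path_cycle _ (joins_src_tgt a) nl (two_connected_connectD1 hH aH).
  by rewrite !inE eqxx.
exists [set e i | i : 'I_n.+2]; first by exists n.+2, v, e; split.
by rewrite -ea imset_f.
Qed.

(* In a cactus, two arcs sharing a vertex of a 2-connected subgraph lie on the *)
(* same simple cycle; by connectedness that cycle contains all the arcs.       *)
Lemma cactus_two_connected H : cactus G -> two_connected H ->
  exists2 C, simple_cycle C & sub_arcs H \subset C.
Proof.
move=> hG hH; have [nl _ cF conn _] := hH.
have /card_gt0P[a aH] : 0 < #|sub_arcs H| by apply: ltnW.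
have [C hC aC] := two_connected_arc_cycle hH aH.
exists C => //.
have share b c u s t : b \in sub_arcs H -> c \in sub_arcs H ->
    joins b u s -> joins c u t -> b \in C -> c \in C.
  move=> bH cH bu cu bC; have [<- //|bc] := eqVneq b c.
  have [C' hC' /andP[bC' cC']] := two_connected_cycle_through hH bH cH bc bu cu.
  by rewrite (hG b C C').
have reach u : connect (adjacent (sub_arcs H)) (src a) u ->
    forall b w, b \in sub_arcs H -> joins b u w -> b \in C.
  case/connectP=> p; elim/last_ind: p u => [|p v IHp] u.
    by move=> _ -> b w bH bu; exact: share aH bH (joins_src_tgt a) bu aC.
  rewrite rcons_path last_rcons => /andP[pH /exists_inP[c cH cv]] -> b w bH bv.
  have cC := IHp _ pH erefl _ _ cH cv.
  by rewrite joins_sym in cv; exact: share cH bH cv bv cC.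
apply/subsetP => b bH.
have /andP[sa _] := joins_sub aH (joins_src_tgt a).
have /andP[sb _] := joins_sub bH (joins_src_tgt b).
by apply: (reach (src b)) bH (joins_src_tgt b); case: conn => _; apply.
Qed.

(** A cycle containing all arcs of the block assigns to each arc [e i] its own vertex [v i], which
    lies in the block. *)
Lemma cactus_block_card H : cactus G -> is_block H ->
  #|sub_arcs H| <= #|sub_vertices H|.
Proof.
move=> hG [[hH _]|[a [_ -> ->]]]; last first.
  by rewrite cards1 card_gt0; apply/set0Pn; exists (src a); rewrite !inE eqxx.
have [C [n [v [e [_ v_inj e_inj ev CE]]]] /subsetP sub] :=
  cactus_two_connected hG hH.
have -> : sub_arcs H = e @: (e @^-1: sub_arcs H).
  apply/setP => a; apply/idP/imsetP => [aH|[i + ->]]; last by rewrite inE.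
  have := sub a aH; rewrite CE => /imsetP[i _ ai].
  by exists i; rewrite // inE -ai.
rewrite card_imset // -(card_imset _ v_inj) subset_leq_card //.
apply/subsetP => _ /imsetP[i + ->]; rewrite inE => eiH.
by case/andP: (joins_sub eiH (ev i)).
Qed.

End Blocks.

(** * Split closures *)

Lemma block_coords_is_linear (R : realType) (G : digraph) (k : nat)
    (Gs : 'I_k -> subgraph G) (B : 'I_k -> finType) (j : 'I_k) :
  linear (block_coords Gs j : mixed_space R _ {j : 'I_k & B j} -> _).
Proof.
move=> c p q; congr pair; apply/ffunP => i; rewrite !ffunE /=.
  by rewrite /xcoord /= !ffunE.
by rewrite /zcoord /= !ffunE.
Qed.

HB.instance Definition _ (R : realType) (G : digraph) (k : nat)
    (Gs : 'I_k -> subgraph G) (B : 'I_k -> finType) (j : 'I_k) :=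
  GRing.isLinear.Build R _ _ _ _ (@block_coords_is_linear R G k Gs B j).

Section BlockCoordinates.
Variables (R : realType) (I : pesp R) (k : nat)
  (Gs : 'I_k -> subgraph (network I)) (B : 'I_k -> finType)
  (Gamma : forall j, B j -> {ffun arcT (subgraph_digraph (Gs j)) -> int}).
Arguments Gamma : clear implicits.

Lemma sum_union_basis (b : {j : 'I_k & B j}) (x : arcT (network I) -> R) :
  \sum_a (union_basis Gamma b a)%:~R * x a =
  \sum_a (Gamma (tag b) (tagged b) a)%:~R * x (val a).
Proof.
rewrite (bigID (mem (sub_arcs (Gs (tag b))))) /=.
rewrite [X in _ + X]big1 ?addr0; last first.
  by move=> a aH; rewrite ffunE insubF ?mul0r //; apply/negbTE.
rewrite big_sub; apply: eq_bigr => a _.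
by rewrite ffunE valK.
Qed.

(** What the split closure sees of the block decomposition is that it partitions the arcs. *)
Hypothesis cover : forall a, exists j, a \in sub_arcs (Gs j).
Hypothesis disjoint : forall a i j,
  a \in sub_arcs (Gs i) -> a \in sub_arcs (Gs j) -> i = j.

Lemma frac_polytope_blocks
    (p : mixed_space R (arcT (network I)) {j : 'I_k & B j}) :
  frac_polytope (union_basis Gamma) p <->
  forall j, @frac_polytope R (subinstance (Gs j)) (B j) (Gamma j)
    (block_coords Gs j p).
Proof.
split=> [[eqp bdp] j|hp]; split=> [b|a].
- have := eqp (Tagged B b); rewrite sum_union_basis /= /zcoord /= ffunE => <-.
  by apply: eq_bigr => a _; rewrite /xcoord /= ffunE.
- by rewrite /xcoord /= !ffunE.
- rewrite sum_union_basis; case: b => j b /=.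
  have [+ _] := hp j => /(_ b); rewrite /zcoord /= ffunE => <-.
  by apply: eq_bigr => a _; rewrite /xcoord /= ffunE.
have [j aj] := cover a; have [_ /(_ (exist _ a aj))] := hp j.
by rewrite /xcoord /= !ffunE.
Qed.

Lemma block_coords_inj
    (p q : mixed_space R (arcT (network I)) {j : 'I_k & B j}) :
  (forall j, block_coords Gs j p = block_coords Gs j q) -> p = q.
Proof.
case: p q => [px pz] [qx qz] pq; congr pair; apply/ffunP.
  move=> a; have [j aj] := cover a.
  have := congr1 (@xcoord _ _ _ ^~ (exist _ a aj)) (pq j).
  by rewrite /xcoord /= !ffunE.
move=> [j b]; have := congr1 (@zcoord _ _ _ ^~ b) (pq j).
by rewrite /zcoord /= !ffunE.
Qed.

Lemma block_coords_surj
    (y : forall j, mixed_space R (arcT (subgraph_digraph (Gs j))) (B j)) :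
  exists q, forall j, block_coords Gs j q = y j.
Proof.
have [blk blkP] := fin_all_exists cover.
exists ([ffun a => (y (blk a)).1 (exist _ a (blkP a))],
        [ffun b => (y (tag b)).2 (tagged b)]) => j.
rewrite [RHS]surjective_pairing; congr pair; apply/ffunP; last first.
  by move=> b; rewrite ffunE /zcoord /= ffunE.
move=> a; rewrite ffunE /xcoord /= ffunE; case: a => a aj /=.
(* The membership proof is generalized first, so that its type follows when [blk a] is replaced by
   [j]. *)
move: (blkP a); rewrite (disjoint (blkP a) aj) => aj'.
by rewrite (bool_irrelevance aj' aj).
Qed.

Lemma convex_hull_blocks
    (S : forall j, set (mixed_space R (arcT (subgraph_digraph (Gs j))) (B j)))
    (p : mixed_space R (arcT (network I)) {j : 'I_k & B j}) :
    (forall j, convex_hull (S j) (block_coords Gs j p)) ->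
  convex_hull [set q | forall j, S j (block_coords Gs j q)] p.
Proof.
apply: (convex_hull_product (f := fun j => block_coords Gs j)).
  exact: block_coords_inj.
exact: block_coords_surj.
Qed.

Lemma split_closure_blocks :
  split_closure (frac_polytope (union_basis Gamma)) =
  block_product (fun j : 'I_k =>
    split_closure (@frac_polytope R (subinstance (Gs j)) (B j) (Gamma j))).
Proof.
apply/seteqP; split=> p hp.
  move=> j /= beta _.
  (* [untag 0] extends [beta] by zero to the cycles of the other blocks. *)
  have := hp [ffun b => untag 0 beta b] Logic.I.
  apply: convex_hull_linear => q [/frac_polytope_blocks/(_ j) qP qint].
  split=> //; move: qint; rewrite big_sig_tag (bigD1 j) //=.
  rewrite [X in _ + X]big1 ?addr0 => [|i ij]; last first.
    by rewrite big1 // => b _; rewrite ffunE untag_dflt ?mul0r.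
  congr (_ \is a _); apply: eq_bigr => b _.
  rewrite ffunE (untagE _ _ (erefl : tag (Tagged B b) = j)) /=.
  by rewrite /zcoord /= ffunE.
move=> beta _.
(* A fixed [beta] selects one split in each block; points integral for all of these are integral for
   [beta]. *)
have := convex_hull_blocks (fun j => hp j [ffun b => beta (Tagged B b)] Logic.I).
apply: convex_hull_mono => q hq; split.
  by apply/frac_polytope_blocks => j; case: (hq j).
rewrite big_sig_tag; apply: rpred_sum => j _.
have [_] := hq j; by under eq_bigr do rewrite ffunE /zcoord /= ffunE.
Qed.

Lemma split_closure_int_polytope : (forall j, (#|B j| <= 1)%N) ->
  split_closure (frac_polytope (union_basis Gamma)) =
  int_polytope (union_basis Gamma).
Proof.
move=> B1; apply/seteqP; split=> p hp; last first.
  move=> beta _; apply: convex_hull_mono hp => q [qP qint]; split=> //.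
  by apply: rpred_sum => b _; rewrite rpredM ?intr_int.
rewrite split_closure_blocks in hp.
(* With at most one cycle in block [j], the all-ones functional is the cycle coordinate itself, so
   these splits make every coordinate of [z] integral simultaneously. *)
have := convex_hull_blocks (fun j => hp j [ffun=> 1] Logic.I).
apply: convex_hull_mono => q hq; split.
  by apply/frac_polytope_blocks => j; case: (hq j).
move=> [j b]; have [_] := hq j; congr (_ \is a _).
rewrite (bigD1 b) //= big1 ?addr0 => [|b' /negP[]]; last first.
  by apply/eqP; move/card_le1_eqP: (B1 j); apply.
by rewrite ffunE mul1r /zcoord /= ffunE.
Qed.

End BlockCoordinates.

(** The rank formula in [integral_cycle_basis] turns the bound of arcs by vertices into a bound on
    the rank. *)
Lemma block_basis_card (G : digraph) (H : subgraph G) (B : finType)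
    (Gamma : B -> {ffun arcT (subgraph_digraph H) -> int}) :
    cactus G -> is_block H -> integral_cycle_basis Gamma ->
  (#|B| <= 1)%N.
Proof.
move=> hG hH [_ + _]; rewrite !card_sig => cardE.
rewrite -(leq_add2r #|sub_vertices H|) cardE addnC leq_add2l.
exact: cactus_block_card.
Qed.

Theorem theorem5p6 (R : realType) (I : pesp R) (hI : pesp_instance I)
    (k : nat) (Gs : 'I_k -> subgraph (network I)) (hGs : blocks_enum Gs)
    (B : 'I_k -> finType)
    (Gamma : forall j, B j -> {ffun arcT (subgraph_digraph (Gs j)) -> int})
    (hGamma : forall j, integral_cycle_basis (Gamma j)) :
  split_closure (frac_polytope (union_basis Gamma)) =
    block_product (fun j : 'I_k =>
      split_closure (@frac_polytope R (subinstance (Gs j)) (B j) (Gamma j)))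
  /\
  (cactus (network I) ->
   split_closure (frac_polytope (union_basis Gamma)) =
   int_polytope (union_basis Gamma)).
Proof.
have [hG _] := hI; have [Gs_inj Gs_blocks] := hGs.
have block j : is_block (Gs j) by apply/Gs_blocks; exists j.
have cover a : exists j, a \in sub_arcs (Gs j).
  have [H /Gs_blocks[j <-] aH] := arc_in_block a hG.
  by exists j.
have disjoint a i j : a \in sub_arcs (Gs i) -> a \in sub_arcs (Gs j) -> i = j.
  by move=> ai aj; apply: Gs_inj; exact: block_unique ai aj.
split; first exact: split_closure_blocks.
move=> hcactus; apply: split_closure_int_polytope => // j.
exact: block_basis_card hcactus (block j) (hGamma j).
Qed.
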